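(* If $B_n$ is any polyomino chain with $n\geq 3$ squares, then $$ABC(B_n)\leq ABC(Z_n),$$ with equality if and only if $B_n\cong Z_n$.
   Context: A polyomino system is a finite 2-connected plane graph in which each interior face is a regular (unit) square of side length one. Two squares are adjacent if they share an edge. A polyomino chain is a polyomino system in which every square is adjacent to at most two squares; its squares form a sequence $C_1,\dots,C_n$ in which exactly consecutive squares are adjacent. A square adjacent to only one other square is terminal; a square adjacent to two other squares is non-terminal. A kink is a non-terminal square having a vertex of degree 2 (degrees are taken in the graph of the chain). The zigzag chain $Z_n$ is the polyomino chain with $n$ squares consisting only of kinks and terminal squares. The atom-bond connectivity index of a graph $G$ with edge set $E(G)$ and vertex degrees $d_u$ is $ABC(G)=\sum_{uv\in E(G)}\sqrt{\frac{d_u+d_v-2}{d_ud_v}}$. *)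

(* Defs.v *)
From HB Require Import structures.
From mathcomp Require Import all_boot all_order all_algebra finmap reals.

Set Implicit Arguments.
Unset Strict Implicit.
Unset Printing Implicit Defensive.

Import Order.TTheory GRing.Theory Num.Theory.
Local Open Scope fset_scope.
Local Open Scope ring_scope.

(* A plane graph all of whose interior faces are unit squares and which is
   2-connected has, up to an isometry, its vertices in Z^2 and its edges among
   the unit segments joining lattice neighbours.  Such a graph has no isolated
   vertex, so it is given by its finite set of edges.  The edge (p, false) is
   the segment from p to p + (1, 0), the edge (p, true) the one from p to
   p + (0, 1); hence every segment has exactly one encoding.  A unit cell of the
   lattice is named by its lower left corner. *)
Notation point := (int * int)%type.
Notation cell := (int * int)%type (only parsing).
Notation edge := (point * bool)%type.
Notation lgraph := {fset edge}.

Definition org (e : edge) : point := e.1.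

Definition dst (e : edge) : point :=
  if e.2 then (e.1.1, e.1.2 + 1) else (e.1.1 + 1, e.1.2).

Definition ends (e : edge) : {fset point} := [fset org e; dst e].

Definition sides (c : cell) : {fset edge} :=
  [fset (c, false); (c, true);
        ((c.1, c.2 + 1), false); ((c.1 + 1, c.2), true)].

Definition corners (c : cell) : {fset point} :=
  [fset c; (c.1 + 1, c.2); (c.1, c.2 + 1); (c.1 + 1, c.2 + 1)].

Definition vertices (G : lgraph) : {fset point} :=
  [fset org e | e in G] `|` [fset dst e | e in G].

Definition adj (G : lgraph) : rel point :=
  fun p q => has (fun e => ends e == [fset p; q]) G.

Definition deg (G : lgraph) (p : point) : nat :=
  #|` [fset e in G | p \in ends e]|.

(* The subgraph of G induced by the set A of vertices is connected. *)
Definition connected_on (G : lgraph) (A : {fset point}) : Prop :=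
  forall p q, p \in A -> q \in A ->
    exists s : seq point,
      [/\ path (adj G) p s, last p s = q & {subset s <= A}].

Definition two_connected (G : lgraph) : Prop :=
  [/\ (2 < #|` vertices G|)%N,
      connected_on G (vertices G) &
      forall z, z \in vertices G -> connected_on G (vertices G `\ z)].

(* A face of G, i.e. a connected component of the complement of the drawing of
   G in the plane, is a union of cells: it is recovered by walking from cell to
   cell across common sides that are not edges of G. *)
Definition cross (G : lgraph) : rel cell :=
  fun c c' => (sides c `&` sides c') `\` G != fset0.

Definition same_face (G : lgraph) (c c' : cell) : Prop :=
  exists s : seq cell, path (cross G) c s /\ last c s = c'.

Definition in_interior_face (G : lgraph) (c : cell) : Prop :=
  exists A : {fset cell}, forall c', same_face G c c' -> c' \in A.

(* The cells that are faces of G on their own.  Filtering the origins of the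
   edges loses nothing, since c is the origin of the bottom side of c. *)
Definition squares (G : lgraph) : {fset cell} :=
  [fset c in [fset org e | e in G] | sides c `<=` G].

Definition polyomino_system (G : lgraph) : Prop :=
  two_connected G /\ forall c, in_interior_face G c -> c \in squares G.

Definition sq_adjacent (c c' : cell) : bool :=
  (c != c') && (sides c `&` sides c' != fset0).

Definition sq_neighbours (G : lgraph) (c : cell) : {fset cell} :=
  [fset c' in squares G | sq_adjacent c c'].

Definition polyomino_chain (n : nat) (G : lgraph) : Prop :=
  [/\ polyomino_system G,
      forall c, c \in squares G -> (#|` sq_neighbours G c| <= 2)%N &
      exists C : n.-tuple cell,
        [/\ uniq C, C =i squares G &
            forall i j : 'I_n,
              sq_adjacent (tnth C i) (tnth C j) =
                ((i.+1 == j :> nat) || (j.+1 == i :> nat))]].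

Definition terminal (G : lgraph) (c : cell) : Prop :=
  c \in squares G /\ #|` sq_neighbours G c| = 1%N.

Definition non_terminal (G : lgraph) (c : cell) : Prop :=
  c \in squares G /\ #|` sq_neighbours G c| = 2%N.

Definition kink (G : lgraph) (c : cell) : Prop :=
  non_terminal G c /\ exists2 p, p \in corners c & deg G p = 2%N.

(* G is a copy of Z_n.  For n >= 2 such G exist, e.g. the staircase of the cells
   (uphalf i, i./2) for i < n, and they are all congruent. *)
Definition zigzag_chain (n : nat) (G : lgraph) : Prop :=
  polyomino_chain n G /\
  forall c, c \in squares G -> kink G c \/ terminal G c.

Definition ABC (R : realType) (G : lgraph) : R :=
  \sum_(e <- G)
     Num.sqrt (((deg G (org e))%:R + (deg G (dst e))%:R - 2)
               / ((deg G (org e))%:R * (deg G (dst e))%:R)).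

Definition graph_iso (G H : lgraph) : Prop :=
  exists f : point -> point,
    [/\ {in vertices G &, injective f},
        [fset f p | p in vertices G] = vertices H &
        {in vertices G &, forall p q, adj H (f p) (f q) = adj G p q}].

(* Main.v *)
Require Import Defs.
From HB Require Import structures.
From mathcomp Require Import all_boot all_order all_algebra finmap reals.
From mathcomp Require Import zify ring lra.
Import Order.TTheory GRing.Theory Num.Theory.
Set Implicit Arguments.
Unset Strict Implicit.
Unset Printing Implicit Defensive.
Local Open Scope fset_scope.
Local Open Scope ring_scope.

(** The weight of an edge depends only on the degrees of its ends; it is
    sqrt (1/2) as soon as one of the two is 2, and it never increases when
    degrees from 2 upwards grow (wt2, wt_anti).  A chain of n squares has 3 n + 1
    edges, n - 1 of them shared by two consecutive squares, so only the
    degrees matter, and those are governed by the inner squares at which the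
    chain goes straight on.

    At an inner square where the chain turns, its two unshared sides weigh at
    most sqrt (1/2) each, and one end of each adjacent shared side lies on
    three squares, hence has degree 4.  Where the chain goes straight on, the
    two unshared sides join vertices of degree at least 3 and weigh at most
    2/3 each; in exchange the two adjacent shared sides may weigh more.
    The weights w33 = 2/3, w34, w44 of a shared side are concave in the number
    of its ends of degree 4 (wt_concave), so each of the two shared sides gains
    at most w34 - w44, which is less than sqrt (1/2) - 2/3 (wt_gap).  Therefore
    every straight passage costs a fixed positive amount compared with the
    zigzag value (strip_bound).  Squares which touch only at a corner do no
    harm: that raises degrees, and all degree estimates are lower bounds.

    A chain without straight passages must alternate its turns, since two
    equal turns in a row would close a block of four squares
    (turns_alternate).  It is thus the image of the standard staircase under a
    symmetry of the lattice (turn_iso).  On the staircase the degrees are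
    explicit and the bound is attained (stair_value_le).  So the zigzag value
    is the maximum, reached exactly by the chains isomorphic to Z_n.

    All this presupposes that the edges of the graph are exactly the sides of
    its squares (edge_in_square).  By 2-connectedness an edge e lies on a
    closed walk that runs through e just once.  Assign to each cell the parity
    of the number of steps of that walk crossing the ray going down from the
    centre of the cell.  This winding parity is constant on every face,
    vanishes far away and differs on the two sides of e; so a cell beside e
    lies in an interior face, and by hypothesis it is a square. *)

(** * Unit steps and parities along a walk *)

Definition is_step (e : edge) : rel point :=
  fun p q => ((p == org e) && (q == dst e)) || ((p == dst e) && (q == org e)).

Definition unit_step : rel point :=
  fun p q => (`|p.1 - q.1| + `|p.2 - q.2| == 1)%N.

Lemma org_neq_dst (e : edge) : org e != dst e.
Proof. by case: e => -[x y] [] ; rewrite /org /dst /= xpair_eqE; lia. Qed.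

Lemma ends_step (e : edge) (p q : point) :
  (ends e == [fset p; q]) = is_step e p q.
Proof.
apply/idP/idP => [/eqP E|].
- move/fsetP: E => H; have ne := org_neq_dst e; rewrite /is_step.
  have:= H (org e); have := H (dst e); have := H p; have := H q.
  rewrite !inE !eqxx /= ?orbT (eq_sym (org e) p) (eq_sym (org e) q).
  rewrite (eq_sym (dst e) p) (eq_sym (dst e) q).
  have : (p == org e) && (p == dst e) = false.
    by apply/negP => /andP[/eqP->]; apply/negP.
  have : (q == org e) && (q == dst e) = false.
    by apply/negP => /andP[/eqP->]; apply/negP.
  by do 4![case: (_ == _) => //=].
- by rewrite /ends /is_step => /orP[] /andP[/eqP-> /eqP->] //; rewrite fsetUC.
Qed.

Lemma adj_step (G : lgraph) (p q : point) :
  adj G p q = has (fun e => is_step e p q) G.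
Proof. by rewrite /adj; apply: eq_has => e; rewrite ends_step. Qed.

Lemma is_step_unit (e : edge) (p q : point) : is_step e p q -> unit_step p q.
Proof.
case: e => -[x y] b; case: p => p1 p2; case: q => q1 q2.
by rewrite /is_step /unit_step /org /dst; case: b => /=; rewrite !xpair_eqE; lia.
Qed.

Lemma adj_unit (G : lgraph) (p q : point) : adj G p q -> unit_step p q.
Proof. by rewrite adj_step => /hasP[e _ /is_step_unit]. Qed.

Lemma is_step_inj (e e' : edge) (p q : point) :
  is_step e p q -> is_step e' p q -> e = e'.
Proof.
case: e => -[x y] b; case: e' => -[x' y'] b'; case: p => p1 p2; case: q => q1 q2.
move=> h h'; apply/eqP; move: h h'.
by rewrite /is_step /org /dst; case: b; case: b' => /=; rewrite !xpair_eqE; lia.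
Qed.

Fixpoint step_parity (r : rel point) (p : point) (s : seq point) : bool :=
  if s is q :: s' then r p q (+) step_parity r q s' else false.

Lemma step_parity_cat r p s t :
  step_parity r p (s ++ t) = step_parity r p s (+) step_parity r (last p s) t.
Proof. by elim: s p => [|q s IH] p //=; rewrite IH addbA. Qed.

(** A closed walk crosses every cut an even number of times: this elementary
    fact replaces the Jordan curve theorem below. *)
Lemma step_parity_cut (S : pred point) p s :
  step_parity (fun p q => S p (+) S q) p s = S p (+) S (last p s).
Proof.
elim: s p => [|q s IH] p /=; first by rewrite addbb.
by rewrite IH -addbA addKb.
Qed.

Lemma step_parityD (r r' : rel point) p s :
  step_parity (fun p q => r p q (+) r' p q) p s =
  step_parity r p s (+) step_parity r' p s.
Proof.
elim: s p => [|q s IH] p //=; rewrite IH.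
by rewrite -!addbA; congr addb; rewrite addbCA.
Qed.

Lemma eq_step_parity (e r r' : rel point) p s : path e p s ->
  {in p :: s &, forall p q, e p q -> r p q = r' p q} ->
  step_parity r p s = step_parity r' p s.
Proof.
elim: s p => [|q s IH] p //= /andP[epq es] H.
rewrite H ?inE ?eqxx ?orbT // IH // => a b Ha Hb.
by apply: H; rewrite inE ?Ha ?Hb orbT.
Qed.

Lemma step_parity0 p s : step_parity (fun _ _ => false) p s = false.
Proof. by elim: s p => //= q s ->. Qed.

Lemma unit_step_cases (p1 p2 q1 q2 : int) : unit_step (p1, p2) (q1, q2) ->
  [\/ q1 = p1 + 1 /\ q2 = p2, p1 = q1 + 1 /\ q2 = p2,
      q1 = p1 /\ q2 = p2 + 1 | q1 = p1 /\ p2 = q2 + 1].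
Proof.
rewrite /unit_step /= => h.
have [[]|[[]|[[]|[]]]] : (q1 = p1 + 1 /\ q2 = p2) \/ (p1 = q1 + 1 /\ q2 = p2) \/
      (q1 = p1 /\ q2 = p2 + 1) \/ (q1 = p1 /\ p2 = q2 + 1) by lia.
- by constructor 1.
- by constructor 2.
- by constructor 3.
- by constructor 4.
Qed.

(** * The winding parity of a closed walk *)

(** Summed along a closed walk, this gives the winding parity of the walk around
    c: it selects the steps that cross the downward ray from the centre of c. *)
Definition below (c : cell) : rel point := fun p q =>
  (((p.1 == c.1) && (q.1 == c.1 + 1)) || ((q.1 == c.1) && (p.1 == c.1 + 1)))
  && (p.2 <= c.2).

Lemma parity_above (c : cell) p s : path unit_step p s -> last p s = p ->
  step_parity (below c) p s (+) step_parity (below (c.1, c.2 + 1)) p s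
  = step_parity (is_step ((c.1, c.2 + 1), false)) p s.
Proof.
case: c => x y us _ /=; rewrite -step_parityD; apply: eq_step_parity us _.
move=> [p1 p2] [q1 q2] _ _ /unit_step_cases[][-> ->];
  rewrite /below /is_step /org /dst /= !xpair_eqE ?(inj_eq (addIr 1)) ?andbb ?orbb; lia.
Qed.

(** The two downward rays from the centres bound a half-strip which contains the
    lattice points on and below the common side's lower end; steps leaving this
    set of points cross one of the rays or run along the common side. *)
Lemma parity_right (c : cell) p s : path unit_step p s -> last p s = p ->
  step_parity (below c) p s (+) step_parity (below (c.1 + 1, c.2)) p s
  = step_parity (is_step ((c.1 + 1, c.2), true)) p s.
Proof.
case: c => x y us ls /=.
pose S (q : point) := (q.1 == x + 1) && (q.2 <= y).
(* The cut around S is crossed an even number of times, so it may be added. *)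
rewrite -step_parityD -[RHS]addFb.
have <- : step_parity (fun p q => S p (+) S q) p s = false.
  by rewrite step_parity_cut ls addbb.
rewrite -step_parityD; apply: eq_step_parity us _.
move=> [p1 p2] [q1 q2] _ _ /unit_step_cases[][-> ->];
  rewrite /below /is_step /S /org /dst /= !xpair_eqE;
  rewrite ?(inj_eq (addIr 1)) ?andbb ?orbb; lia.
Qed.

(** * Every edge of a polyomino system lies on a square *)

Lemma walk_bounded (p : point) (s : seq point) :
  exists M : nat, {in p :: s, forall q, (`|q.1| <= M)%N && (`|q.2| <= M)%N}.
Proof.
elim: s p => [|q s IH] p.
  by exists (maxn `|p.1| `|p.2|)%N => q; rewrite inE => /eqP->; lia.
have [M HM] := IH q; exists (maxn M (maxn `|p.1| `|p.2|))%N => a.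
rewrite inE => /orP[/eqP->|/HM]; lia.
Qed.

(** Left, right and below of the walk no step meets the ray; above the walk the ray
    meets all the steps across a vertical line, and there is an even number of
    those. *)
Lemma below_far (M : nat) (c : cell) p s :
  path unit_step p s -> last p s = p ->
  {in p :: s, forall q, (`|q.1| <= M)%N && (`|q.2| <= M)%N} ->
  step_parity (below c) p s -> (`|c.1| <= M.+1)%N && (`|c.2| <= M.+1)%N.
Proof.
case: c => x y us ls HM /=; apply: contraTT => far.
have [yM|yM] := leP (M%:Z) y.
  have -> : step_parity (below (x, y)) p s =
    step_parity (fun p q => (p.1 <= x) (+) (q.1 <= x)) p s.
    apply: eq_step_parity us _ => -[p1 p2] [q1 q2] /HM /= h1 /HM /= h2.
    by move=> /unit_step_cases[][? ?]; rewrite /below /=; subst; lia.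
  by rewrite (step_parity_cut (fun p => p.1 <= x)) ls addbb.
rewrite (eq_step_parity (r' := fun _ _ => false) us) ?step_parity0 //.
move=> [p1 p2] [q1 q2] /HM /= h1 /HM /= h2 _; rewrite /below /=; lia.
Qed.

Lemma box_finite (M : nat) :
  exists A : {fset cell},
    forall c : cell, (`|c.1| <= M)%N && (`|c.2| <= M)%N -> c \in A.
Proof.
pose r : seq int := [seq i%:Z - M%:Z | i <- iota 0 (M + M).+1].
exists [fset c in [seq (x, y) | x <- r, y <- r]] => -[x y] h.
have Hr z : (`|z| <= M)%N -> z \in r.
  by move=> hz; apply/mapP; exists (absz (z + M%:Z)); rewrite ?mem_iota; lia.
have [hx hy] := andP h.
have xy := allpairs_f (fun x y : int => (x, y)) (Hr x hx) (Hr y hy).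
by rewrite in_fset.
Qed.

(** The two cells having e as a side; membership in this short list is easier to
    compute with than membership of e in the finite set of sides of a cell. *)
Definition beside (e : edge) : seq cell :=
  [:: e.1; if e.2 then (e.1.1 - 1, e.1.2) else (e.1.1, e.1.2 - 1)].

Lemma mem_sides (e : edge) (c : cell) : (e \in sides c) = (c \in beside e).
Proof.
rewrite /sides !in_fsetU !in_fset1 !inE.
case: e => -[x y] [] ; case: c => a b; rewrite /= !xpair_eqE ?andbF ?andbT; lia.
Qed.

Lemma common_side (g : edge) (c c' : cell) :
  c \in beside g -> c' \in beside g -> c != c' ->
  [\/ c' = (c.1, c.2 + 1) /\ g = (c', false),
      c = (c'.1, c'.2 + 1) /\ g = (c, false),
      c' = (c.1 + 1, c.2) /\ g = (c', true) |
      c = (c'.1 + 1, c'.2) /\ g = (c, true)].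
Proof.
move=> h h' ne; move: h h'; rewrite !inE => h h'.
case: g h h' => -[gx gy] b; case: c ne => x y; case: c' => x' y' ne h h'.
rewrite /= in h h' ne *.
have [|[|[|]]] :
  ((x' == x) && (y' == y + 1) && ((gx == x') && (gy == y') && (b == false))) \/
  ((x == x') && (y == y' + 1) && ((gx == x) && (gy == y) && (b == false))) \/
  ((x' == x + 1) && (y' == y) && ((gx == x') && (gy == y') && (b == true))) \/
  ((x == x' + 1) && (y == y') && ((gx == x) && (gy == y) && (b == true))) by
  move: h h' ne; case: b => /=; rewrite !xpair_eqE ?andbF ?andbT /=; lia.
all: move=> /andP[/andP[/eqP-> /eqP->] /andP[/andP[/eqP-> /eqP->] /eqP->]].
- by constructor 1.
- by constructor 2.
- by constructor 3.
- by constructor 4.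
Qed.

Lemma winding_side (g : edge) (c c' : cell) p s :
  path unit_step p s -> last p s = p ->
  c \in beside g -> c' \in beside g -> c != c' ->
  step_parity (below c) p s (+) step_parity (below c') p s =
  step_parity (is_step g) p s.
Proof.
move=> us ls gc gc' /(common_side gc gc')[][-> ->].
- exact: parity_above.
- by rewrite addbC; exact: parity_above.
- exact: parity_right.
- by rewrite addbC; exact: parity_right.
Qed.

(** The winding parity only changes across edges used by the walk, hence is
    constant on faces; being zero outside a box, it marks bounded faces. *)
Lemma winding_interior (G : lgraph) (c : cell) p s :
  path (adj G) p s -> last p s = p -> step_parity (below c) p s ->
  in_interior_face G c.
Proof.
move=> ps ls wc.
have us : path unit_step p s by apply: sub_path ps => a b; exact: adj_unit.
have [M HM] := walk_bounded p s.
have [A HA] := box_finite M.+1; exists A => c' [t [ct <-]] {c'}.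
apply: HA; apply: (below_far us ls HM).
elim: t c wc ct => [|d t IH] c wc //= /andP[/fset0Pn[g]].
rewrite in_fsetD in_fsetI => /andP[gG /andP[gc gd]] dt; apply: IH dt.
rewrite mem_sides in gc; rewrite mem_sides in gd.
have [<- //|ne] := eqVneq c d.
move: (winding_side us ls gc gd ne); rewrite wc.
suff -> : step_parity (is_step g) p s = false by case: step_parity.
rewrite (eq_step_parity (r' := fun _ _ => false) ps) ?step_parity0 //.
move=> a b _ _; rewrite adj_step => /hasP[e eG sab]; apply: contraNF gG => gab.
by rewrite (is_step_inj gab sab).
Qed.

(** With w a third vertex, walk from org e to w avoiding dst e, then from w to
    dst e avoiding org e, and come back along e: neither of the first two parts
    can use e. *)
Lemma closed_walk_through (G : lgraph) (e : edge) :
  two_connected G -> e \in G ->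
  exists p s, [/\ path (adj G) p s, last p s = p & step_parity (is_step e) p s].
Proof.
move=> [V2 _ cut] eG; set u := org e; set v := dst e.
have ne : u != v := org_neq_dst e.
have uV : u \in vertices G.
  by rewrite inE; apply/orP; left; apply/imfsetP; exists e.
have vV : v \in vertices G.
  by rewrite inE; apply/orP; right; apply/imfsetP; exists e.
have [w wV /andP[wu wv]] : exists2 w, w \in vertices G & (w != u) && (w != v).
  have /fset0Pn[w] : (vertices G `\ u) `\ v != fset0.
    rewrite -cardfs_gt0; move: V2; rewrite (cardfsD1 u) uV (cardfsD1 v) in_fsetD1.
    by rewrite (eq_sym v) ne vV /=; case: #|` _|.
  by rewrite !in_fsetD1 => /andP[wv /andP[wu wV]]; exists w; rewrite ?wu.
have memD1 x z : x \in vertices G -> x != z -> x \in vertices G `\ z.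
  by move=> xV xz; rewrite in_fsetD1 xz.
have [s1 [p1 l1 a1]] := cut v vV u w (memD1 u v uV ne) (memD1 w v wV wv).
have vu : v != u by rewrite eq_sym.
have [s2 [p2 l2 a2]] := cut u uV w v (memD1 w u wV wu) (memD1 v u vV vu).
exists u, (s1 ++ s2 ++ [:: u]); split.
- rewrite !cat_path p1 l1 p2 l2 /= adj_step andbT; apply/hasP; exists e => //.
  by rewrite /is_step !eqxx orbT.
- by rewrite !last_cat.
rewrite !step_parity_cat l1 l2 /=.
rewrite (eq_step_parity (r' := fun _ _ => false) p1) ?step_parity0; last first.
  have av x : x \in u :: s1 -> x != v.
    by rewrite inE => /orP[/eqP->//|/a1]; rewrite in_fsetD1 => /andP[].
  by move=> x y /av xv /av yv _; rewrite /is_step -/v (negPf xv) (negPf yv) andbF.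
rewrite (eq_step_parity (r' := fun _ _ => false) p2) ?step_parity0; last first.
  have av x : x \in w :: s2 -> x != u.
    by rewrite inE => /orP[/eqP->//|/a2]; rewrite in_fsetD1 => /andP[].
  by move=> x y /av xv /av yv _; rewrite /is_step -/u (negPf xv) (negPf yv) andbF.
by rewrite /is_step !eqxx orbT.
Qed.

Lemma edge_in_square (G : lgraph) (e : edge) :
  polyomino_system G -> e \in G -> exists2 c, c \in squares G & e \in sides c.
Proof.
move=> [G2 face] eG.
have [p [s [ps ls se]]] := closed_walk_through G2 eG.
have us : path unit_step p s by apply: sub_path ps => a b; exact: adj_unit.
pose c1 := e.1; pose c2 := nth c1 (beside e) 1.
have b1 : c1 \in beside e by rewrite inE eqxx.
have b2 : c2 \in beside e by rewrite !inE eqxx orbT.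
have ne : c1 != c2.
  by rewrite /c1 /c2; case: (e) => -[x y] []; rewrite /= xpair_eqE; lia.
move: (winding_side us ls b1 b2 ne); rewrite se.
case E: (step_parity _ _ _) => /= H.
  by exists c1; [exact/face/(winding_interior ps ls)|rewrite mem_sides].
by exists c2; [exact/face/(winding_interior ps ls)|rewrite mem_sides].
Qed.

(** * Degrees in a union of cells *)

Definition tiles (G : lgraph) (cs : seq cell) : Prop :=
  forall e, (e \in G) = has (fun c => c \in beside e) cs.

Definition quadrants (p : point) : seq cell :=
  [:: p; (p.1, p.2 - 1); (p.1 - 1, p.2); (p.1 - 1, p.2 - 1)].

Definition star (p : point) : seq edge :=
  [:: (p, false); (p, true); ((p.1 - 1, p.2), false); ((p.1, p.2 - 1), true)].

Lemma mem_corners (p : point) (c : cell) : (p \in corners c) = (c \in quadrants p).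
Proof.
rewrite /corners !in_fsetU !in_fset1 /quadrants !inE.
by case: p => x y; case: c => a b; rewrite !xpair_eqE /=; lia.
Qed.

Lemma mem_ends (p : point) (e : edge) : (p \in ends e) = (e \in star p).
Proof.
rewrite /ends !in_fsetU !in_fset1 /star !inE /org /dst.
by case: p => x y; case: e => -[a b] []; rewrite /= !xpair_eqE ?andbF ?andbT /=; lia.
Qed.

Lemma deg_count (G : lgraph) (p : point) : deg G p = count [in G] (star p).
Proof.
have u : uniq (star p).
  by case: p => x y; rewrite /= !inE !xpair_eqE /= ?andbF ?andbT; lia.
rewrite -size_filter -(undup_id (filter_uniq [in G] u)) -card_fseq /deg.
by congr #|` _|; apply/fsetP => e; rewrite [RHS]in_fset mem_filter -mem_ends !inE.
Qed.

Lemma tiles_edge (G : lgraph) cs (e : edge) : tiles G cs ->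
  (e \in G) = has [in cs] (beside e).
Proof. by move=> ->; rewrite has_sym. Qed.

(** Each of the four segments at a point belongs to G exactly if at least one of
    the two quadrants along it is a cell. *)
Lemma deg_tiles (G : lgraph) cs (x y : int) : tiles G cs ->
  deg G (x, y) = ((((x, y) \in cs) || ((x, y - 1)%R \in cs)) +
                (((x, y) \in cs) || ((x - 1, y)%R \in cs)) +
                (((x - 1, y)%R \in cs) || ((x - 1, y - 1)%R \in cs)) +
                (((x, y - 1)%R \in cs) || ((x - 1, y - 1)%R \in cs)))%N.
Proof.
move=> tG; rewrite deg_count /= !(tiles_edge _ tG) /beside /=.
by rewrite addn0 !addnA !orbF.
Qed.

Lemma deg_le4 (G : lgraph) (p : point) : (deg G p <= 4)%N.
Proof. by rewrite deg_count (leq_trans (count_size _ _)). Qed.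

Lemma deg_ge2 (G : lgraph) cs p c : tiles G cs ->
  c \in cs -> c \in quadrants p -> (2 <= deg G p)%N.
Proof.
case: p => x y tG; rewrite (deg_tiles _ _ tG) !inE /= => h.
by case/or4P=> /eqP E; move: h; rewrite E => ->; rewrite /= ?orbT;
  case: ((x, y) \in cs); case: ((x, y - 1) \in cs);
  case: ((x - 1, y) \in cs); case: ((x - 1, y - 1) \in cs).
Qed.

Lemma deg_ge3 (G : lgraph) cs p c c' : tiles G cs ->
  c \in cs -> c' \in cs -> c != c' -> c \in quadrants p -> c' \in quadrants p ->
  (3 <= deg G p)%N.
Proof.
case: p => x y tG; rewrite (deg_tiles _ _ tG) !inE /= => h h' ne.
move=> /or4P[]/eqP E /or4P[]/eqP E'; move: h h' ne; rewrite E E' ?eqxx // => -> -> _;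
  by rewrite ?orbT /=; case: ((x, y) \in cs); case: ((x, y - 1) \in cs);
  case: ((x - 1, y) \in cs); case: ((x - 1, y - 1) \in cs).
Qed.

(** Three of the four quadrants already account for all four segments, whereas two
    account for three segments, or for four if they are opposite. *)
Lemma deg_ge4 (G : lgraph) cs p c c' c'' : tiles G cs ->
  c \in cs -> c' \in cs -> c'' \in cs -> c != c' -> c' != c'' -> c != c'' ->
  c \in quadrants p -> c' \in quadrants p -> c'' \in quadrants p -> (4 <= deg G p)%N.
Proof.
case: p => x y tG; rewrite (deg_tiles _ _ tG) !inE /=.
move=> h h' h'' ne ne' ne'' /or4P[]/eqP E /or4P[]/eqP E' /or4P[]/eqP E'';
  move: h h' h'' ne ne' ne''; rewrite E E' E'' ?eqxx // => -> -> -> _ _ _;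
  by rewrite ?orbT /=; case: ((x, y) \in cs); case: ((x, y - 1) \in cs);
  case: ((x - 1, y) \in cs); case: ((x - 1, y - 1) \in cs).
Qed.

(** * Strips of cells and sums over their edges *)

(** The side shared by two adjacent cells; arbitrary if they are not adjacent. *)
Definition border (c c' : cell) : edge :=
  if c.1 == c'.1 then ((c.1, Num.max c.2 c'.2), false)
  else ((Num.max c.1 c'.1, c.2), true).

Lemma common_side_border g c c' :
  c \in beside g -> c' \in beside g -> c != c' -> g = border c c' /\ unit_step c c'.
Proof.
move=> gc gc' /(common_side gc gc'); case: c {gc} => x y; case: c' {gc'} => x' y'.
rewrite /border /unit_step /= => -[][[-> ->] ->]; split; try lia;
  by rewrite ?eqxx; try (case: eqP; [lia|move=> _]); congr (_, _, _); lia.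
Qed.

Lemma border_beside c c' :
  unit_step c c' -> c \in beside (border c c') /\ c' \in beside (border c c').
Proof.
rewrite !inE /border.
case: c => x y; case: c' => x' y' /unit_step_cases[][-> ->] /=.
- have -> : (x == x + 1) = false by lia.
  by rewrite /= !xpair_eqE; lia.
- have -> : (x' + 1 == x') = false by lia.
  by rewrite /= !xpair_eqE; lia.
- by rewrite eqxx /= !xpair_eqE; lia.
- by rewrite eqxx /= !xpair_eqE; lia.
Qed.

Lemma sq_adjacent_unit c c' : sq_adjacent c c' = unit_step c c'.
Proof.
rewrite /sq_adjacent; apply/andP/idP => [[ne /fset0Pn[g]]|u].
  case/fsetIP; rewrite !mem_sides => gc gc'.
  by have [] := common_side_border gc gc' ne.
split; first by apply: contraTneq u => ->; rewrite /unit_step; lia.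
have [b b'] := border_beside u.
by apply/fset0Pn; exists (border c c'); apply/fsetIP; rewrite !mem_sides.
Qed.

Lemma ends_quadrants e c : c \in beside e ->
  c \in quadrants (org e) /\ c \in quadrants (dst e).
Proof.
rewrite !inE /org /dst.
by case: e => -[x y] []; case: c => a b; rewrite /= !xpair_eqE; lia.
Qed.

Definition side_list (c : cell) : seq edge :=
  [:: (c, false); (c, true); ((c.1, c.2 + 1), false); ((c.1 + 1, c.2), true)].

Lemma mem_side_list e c : (e \in side_list c) = (c \in beside e).
Proof.
rewrite !inE.
by case: e => -[x y] []; case: c => a b; rewrite /= !xpair_eqE ?andbF ?andbT /=; lia.
Qed.

Lemma side_list_uniq c : uniq (side_list c).
Proof. by case: c => x y; rewrite /= !inE !xpair_eqE /= ?andbF ?andbT; lia. Qed.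

Definition cells_graph (cs : seq cell) : lgraph :=
  [fset e in flatten [seq side_list c | c <- cs]].

Lemma cells_graph_tiles cs : tiles (cells_graph cs) cs.
Proof.
move=> e; rewrite in_fset; apply/flatten_mapP/hasP => -[c cin ec]; exists c => //.
  by rewrite -mem_side_list.
by rewrite mem_side_list.
Qed.

Lemma tiles_eq G cs : tiles G cs -> G = cells_graph cs.
Proof. by move=> tG; apply/fsetP => e; rewrite tG cells_graph_tiles. Qed.

(** Cells that are not consecutive may still touch at a corner. *)
Definition strip (n : nat) (C : nat -> cell) : Prop :=
  forall i j, (i < j < n)%N ->
    C i != C j /\ unit_step (C i) (C j) = (i.+1 == j).

(** Adding the last cell brings in all its sides but the border with its
    predecessor, because it has no side in common with earlier cells. *)
Lemma strip_sum (V : zmodType) (w : edge -> V) n C : strip n.+1 C ->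
  \sum_(e <- cells_graph (mkseq C n.+1)) w e =
  \sum_(i < n.+1) \sum_(e <- side_list (C i)) w e
    - \sum_(i < n) w (border (C i) (C i.+1)).
Proof.
elim: n => [|n IH] sC.
  rewrite big_ord1 big_ord0 subr0; apply: perm_big; apply: uniq_perm.
  - exact: fset_uniq.
  - exact: side_list_uniq.
  - by move=> e; rewrite cells_graph_tiles mem_side_list /= orbF.
have sC' : strip n.+1 C.
  by move=> i j /andP[ij jn]; apply: sC; rewrite ij ltnW.
rewrite big_ord_recr [X in _ - X]big_ord_recr /= opprD addrACA -IH //.
set b := border _ _.
have un : unit_step (C n) (C n.+1).
  have [|_] := sC n n.+1; first by rewrite !ltnSn.
  by rewrite eqxx.
have [b1 b2] := border_beside un.
have bl : b \in side_list (C n.+1) by rewrite mem_side_list.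
have remE e : e \in rem b (side_list (C n.+1)) = (e != b) && (C n.+1 \in beside e).
  by rewrite -mem_side_list mem_rem_uniq ?side_list_uniq.
rewrite (perm_big _ (perm_to_rem bl)) big_cons addrAC subrr add0r -big_cat.
apply: perm_big; apply: uniq_perm; first exact: fset_uniq.
  rewrite cat_uniq fset_uniq rem_uniq ?side_list_uniq // andbT /=.
  apply/hasPn => e; rewrite remE cells_graph_tiles => /andP[eb en].
  apply/hasPn => _ /mapP[i + ->]; rewrite mem_iota add0n => /andP[_ ilt].
  apply: contraNN eb => ei.
  have [ne adj] : C i != C n.+1 /\ unit_step (C i) (C n.+1) = (i.+1 == n.+1).
    by apply: sC; rewrite ilt ltnSn.
  have [-> un'] := common_side_border ei en ne.
  by move: adj; rewrite un' => /esym/eqP[->].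
move=> e; rewrite mem_cat remE !cells_graph_tiles.
rewrite [mkseq C n.+2]mkseqS -cats1 has_cat has_seq1.
have [->|_] := eqVneq e b; last by [].
rewrite b2 orbT; apply/esym; rewrite orbF; apply/hasP; exists (C n); last exact: b1.
by apply: map_f; rewrite mem_iota /= add0n.
Qed.

(** * The weight of an edge *)

Definition abc_wt (R : realType) (p q : nat) : R :=
  Num.sqrt ((p%:R + q%:R - 2) / (p%:R * q%:R)).

Section Weight.
Variable R : realType.
Local Notation wt := (abc_wt R).

Lemma wtC p q : wt p q = wt q p.
Proof. by rewrite /abc_wt [p%:R + _]addrC [p%:R * _]mulrC. Qed.

Lemma wt2 q : (0 < q)%N -> wt 2 q = wt 2 2.
Proof.
move=> q0; have q0' : q%:R != 0 :> R by rewrite pnatr_eq0 -lt0n.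
by congr Num.sqrt; field.
Qed.

(** For q >= 2 the radicand is 1/q + (1 - 2/q)/p, which does not increase with p. *)
Lemma wt_antil p p' q : (2 <= p)%N -> (p <= p')%N -> (2 <= q)%N ->
  wt p' q <= wt p q.
Proof.
move=> p2 pp' q2; apply: ler_wsqrtr.
have P : 2 <= p%:R :> R by rewrite (ler_nat R 2).
have P' : p%:R <= p'%:R :> R by rewrite ler_nat.
have Q : 2 <= q%:R :> R by rewrite (ler_nat R 2).
move: (p%:R) (p'%:R) (q%:R) P P' Q => x x' y hx hx' hy.
have x0 : 0 < x by lra.
have x0' : 0 < x' by lra.
have y0 : 0 < y by lra.
rewrite -subr_ge0.
have -> : (x + y - 2) / (x * y) - (x' + y - 2) / (x' * y) =
  (y - 2) * (x' - x) / (x * x' * y).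
  by field; rewrite !gt_eqF.
by rewrite divr_ge0 ?mulr_ge0 ?subr_ge0 // ltW.
Qed.

Lemma wt_anti p p' q q' : (2 <= p <= p')%N -> (2 <= q <= q')%N ->
  wt p' q' <= wt p q.
Proof.
move=> /andP[p2 pp'] /andP[q2 qq'].
apply: (le_trans (wt_antil p2 pp' (leq_trans q2 qq'))).
by rewrite ![wt p _]wtC wt_antil.
Qed.

Lemma wt_sqr_bounds (t : R) p q : 0 <= t -> 
   (t ^+ 2 <= (p%:R + q%:R - 2) / (p%:R * q%:R) -> t <= wt p q) /\
   ((p%:R + q%:R - 2) / (p%:R * q%:R) <= t ^+ 2 -> wt p q <= t).
Proof.
move=> t0; split => h.
  by rewrite -[t]ger0_norm // -sqrtr_sqr ler_wsqrtr.
by rewrite -[t]ger0_norm // -sqrtr_sqr ler_wsqrtr.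
Qed.

(** Numerically 2/3, 0.6455 and 0.6124 are the weights for the degree pairs (3, 3),
    (3, 4) and (4, 4); the fractions below separate them. *)
Lemma wt_concave : wt 3 3 + wt 4 4 <= wt 3 4 + wt 3 4.
Proof.
have h33 : wt 3 3 <= 2 / 3 by apply: (wt_sqr_bounds _ _ _).2; lra.
have h44 : wt 4 4 <= 49 / 80 by apply: (wt_sqr_bounds _ _ _).2; lra.
have h34 : 20 / 31 <= wt 3 4 by apply: (wt_sqr_bounds _ _ _).1; lra.
lra.
Qed.

(** The loss of one unshared side at a straight passage exceeds what a shared side
    gains at most from one such passage; the weight of (2, 2) is about 0.7071. *)
Lemma wt_gap : wt 3 4 - wt 4 4 < wt 2 2 - wt 3 3.
Proof.
have h33 : wt 3 3 <= 2 / 3 by apply: (wt_sqr_bounds _ _ _).2; lra.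
have h44 : 11 / 18 <= wt 4 4 by apply: (wt_sqr_bounds _ _ _).1; lra.
have h34 : wt 3 4 <= 31 / 48 by apply: (wt_sqr_bounds _ _ _).2; lra.
have h22 : 12 / 17 <= wt 2 2 by apply: (wt_sqr_bounds _ _ _).1; lra.
lra.
Qed.

End Weight.

(** * Straight passages and turns *)

Lemma unit_stepC c c' : unit_step c c' = unit_step c' c.
Proof. by rewrite /unit_step; apply/idP/idP; lia. Qed.

Lemma borderC c c' : unit_step c c' -> border c c' = border c' c.
Proof.
rewrite /border eq_sym maxC [Num.max c.1 _]maxC; case: c => x y; case: c' => x' y'.
rewrite /unit_step /=; have [->|ne u] // := eqVneq x x'.
by have -> : y = y' by lia.
Qed.

Lemma neighbour_cases c c' : unit_step c c' ->
  [\/ c' = (c.1 + 1, c.2) /\ border c c' = ((c.1 + 1, c.2), true),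
      c' = (c.1 - 1, c.2) /\ border c c' = (c, true),
      c' = (c.1, c.2 + 1) /\ border c c' = ((c.1, c.2 + 1), false) |
      c' = (c.1, c.2 - 1) /\ border c c' = (c, false)].
Proof.
case: c => x y; case: c' => x' y' u; have [b b'] := border_beside u.
have ne : (x, y) != (x', y') by rewrite xpair_eqE; move: u; rewrite /unit_step /=; lia.
case: (common_side b b' ne) => -[e ->].
- by constructor 3; rewrite e.
- constructor 4; move: e => /= [-> ->]; split => //; congr (_, _); lia.
- by constructor 1; rewrite e.
- constructor 2; move: e => /= [-> ->]; split => //; congr (_, _); lia.
Qed.

Definition straight (c0 c1 c2 : cell) : bool :=
  (c2.1 - c1.1 == c1.1 - c0.1) && (c2.2 - c1.2 == c1.2 - c0.2).

Lemma turn_before c0 c1 c2 : unit_step c0 c1 -> unit_step c1 c2 -> c0 != c2 ->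
  ~~ straight c0 c1 c2 ->
  (c0 \in quadrants (org (border c1 c2))) || (c0 \in quadrants (dst (border c1 c2))).
Proof.
rewrite unit_stepC !inE => /neighbour_cases[][-> _] /neighbour_cases[][-> ->];
  by rewrite /straight /org /dst; case: c1 => x y /=; rewrite !xpair_eqE; lia.
Qed.

Lemma turn_after c0 c1 c2 : unit_step c0 c1 -> unit_step c1 c2 -> c0 != c2 ->
  ~~ straight c0 c1 c2 ->
  (c2 \in quadrants (org (border c0 c1))) || (c2 \in quadrants (dst (border c0 c1))).
Proof.
move=> u01 u12 ne s; rewrite borderC //.
apply: turn_before; rewrite 1?unit_stepC // 1?eq_sym //.
by apply: contra s; rewrite /straight; lia.
Qed.

(** Otherwise the four cells would form a 2 x 2 block and c3 would be adjacent to c0. *)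
Lemma turns_alternate c0 c1 c2 c3 :
  unit_step c0 c1 -> unit_step c1 c2 -> unit_step c2 c3 ->
  c0 != c2 -> c1 != c3 -> ~~ straight c0 c1 c2 -> ~~ straight c1 c2 c3 ->
  ~~ unit_step c0 c3 ->
  c3 = (c2.1 + (c1.1 - c0.1), c2.2 + (c1.2 - c0.2)).
Proof.
rewrite unit_stepC => /neighbour_cases[][-> _] /neighbour_cases[][-> _]
   /neighbour_cases[][-> _]; rewrite /straight /unit_step; case: c1 => x y /=;
  rewrite !xpair_eqE => *; congr (_, _); lia.
Qed.

(** As the two turns have opposite senses, they take place around the two different
    ends of the border between c1 and c2. *)
Lemma turn_both c0 c1 c2 c3 :
  unit_step c0 c1 -> unit_step c1 c2 -> 
  c0 != c2 -> ~~ straight c0 c1 c2 -> 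
  c3 = (c2.1 + (c1.1 - c0.1), c2.2 + (c1.2 - c0.2)) ->
  ((c0 \in quadrants (org (border c1 c2))) &&
     (c3 \in quadrants (dst (border c1 c2)))) ||
  ((c0 \in quadrants (dst (border c1 c2))) &&
     (c3 \in quadrants (org (border c1 c2)))).
Proof.
rewrite unit_stepC => /neighbour_cases[][-> _] /neighbour_cases[][-> ->] + + ->;
  by rewrite !inE /straight /org /dst; case: c1 => x y /=; rewrite !xpair_eqE; lia.
Qed.

(** On a straight passage the unshared sides e and e' of c1 run parallel to it, and
    each of their ends is also a corner of c0 or of c2. *)
Lemma inner_sides c0 c1 c2 : unit_step c0 c1 -> unit_step c1 c2 -> c0 != c2 ->
  exists e e', perm_eq (side_list c1) [:: border c0 c1; border c1 c2; e; e'] /\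
    (straight c0 c1 c2 -> {in [:: e; e'], forall f,
      ((c0 \in quadrants (org f)) || (c2 \in quadrants (org f))) &&
      ((c0 \in quadrants (dst f)) || (c2 \in quadrants (dst f)))}).
Proof.
move=> u01 u12 ne; rewrite (borderC u01); rewrite unit_stepC in u01.
set b := border c1 c0; set b' := border c1 c2.
have bs : b \in side_list c1 by rewrite mem_side_list (border_beside u01).1.
have bs' : b' \in side_list c1 by rewrite mem_side_list (border_beside u12).1.
have nb : b' != b.
  rewrite /b /b'; move: ne; case: (neighbour_cases u01) => -[-> ->];
  by case: (neighbour_cases u12) => -[-> ->]; case: (c1) => x y /=;
    rewrite !xpair_eqE; lia.
have bs'' : b' \in rem b (side_list c1).
  by rewrite mem_rem_uniq ?side_list_uniq //; apply/andP.
have := perm_to_rem bs; have := perm_to_rem bs''.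
move: (rem _ (rem _ _)) => l pl; rewrite -(perm_cons b) in pl.
move/perm_trans/(_ pl) => {pl}pl.
have := perm_size pl; case: l pl => [|e [|e' [|]]] //= pl _.
exists e, e'; split=> // st f fl.
have : uniq [:: b; b'; e; e'] by rewrite -(perm_uniq pl) side_list_uniq.
have fs : f \in side_list c1.
  by rewrite (perm_mem pl) !inE; move: fl; rewrite !inE => ->; rewrite !orbT.
move=> /= /andP[B /andP[B' _]].
have fb : f != b.
  by apply: contraNneq B => <-; move: fl; rewrite !inE => ->; rewrite orbT.
have fb' : f != b' by apply: contraNneq B' => <-.
move: fb fb' fs st {pl bs bs' nb bs'' B B' fl}; rewrite /b /b'.
case: (neighbour_cases u01) => -[-> ->]; case: (neighbour_cases u12) => -[-> ->];
  rewrite /straight; case: (c1) => x y; case: f => -[a d] r;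
  rewrite !inE /org /dst /= !xpair_eqE /=;
  case: r => /=; rewrite ?xpair_eqE ?andbF ?andbT ?orbF; lia.
Qed.

Lemma end_sides c c' : unit_step c c' ->
  exists e1 e2 e3, perm_eq (side_list c) [:: border c c'; e1; e2; e3].
Proof.
move=> u; have bs : border c c' \in side_list c.
  by rewrite mem_side_list (border_beside u).1.
have := perm_to_rem bs; move: (rem _ _) => l pl.
have := perm_size pl; case: l pl => [|e [|e' [|e'' [|]]]] //= pl _.
by exists e, e', e''.
Qed.

(** * The upper bound *)

Definition edge_wt (R : realType) (G : lgraph) (e : edge) : R :=
  abc_wt R (deg G (org e)) (deg G (dst e)).

(** With A i the sum over the sides of cell i and B i the weight of the border between
    cells i and i + 1, this splits the sum over a strip into the unshared sides of
    the end cells, those of the inner cells, and the borders, where the first and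
    the last one are singled out because only one of the cells at them is inner. *)
Lemma sum_regroup (R : realType) (m : nat) (A B : nat -> R) :
  \sum_(i < m.+3) A i - \sum_(j < m.+2) B j =
  (A 0%N - B 0%N) + (A m.+2 - B m.+1)
  + \sum_(i < m.+1) (A i.+1 - B i - B i.+1)
  + (B 0%N + B m.+1 + \sum_(j < m) B j.+1).
Proof.
rewrite big_ord_recl big_ord_recr /=.
have -> : \sum_(i < m.+1) (A i.+1 - B i - B i.+1) =
  \sum_(i < m.+1) A i.+1 - (B 0%N + \sum_(i < m) B i.+1) - (\sum_(i < m) B i.+1 + B m.+1).
  rewrite !sumrB; congr (_ - _ - _); first by rewrite big_ord_recl.
  by rewrite big_ord_recr.
have -> : \sum_(j < m.+2) B j = B 0%N + (\sum_(i < m) B i.+1 + B m.+1).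
  by rewrite big_ord_recl big_ord_recr.
move: (\sum_(i < m.+1) A _) (\sum_(i < m) _) => X Y.
by ring.
Qed.

Section Strip.
Variables (R : realType) (m : nat) (C : nat -> cell).
Hypothesis sC : strip m.+3 C.
Variable G : lgraph.
Local Notation cs := (mkseq C m.+3).
Hypothesis tG : tiles G cs.
Local Notation w := (edge_wt R G).
Local Notation wt := (abc_wt R).

Let mem i : (i < m.+3)%N -> C i \in cs.
Proof. by move=> im; apply: map_f; rewrite mem_iota. Qed.

Let step i : (i.+1 < m.+3)%N -> unit_step (C i) (C i.+1).
Proof.
move=> im; have [|_] := sC (i := i) (j := i.+1); first by rewrite ltnSn.
by rewrite eqxx.
Qed.

Let neq i j : (i < j < m.+3)%N -> C i != C j.
Proof. by move=> /sC[]. Qed.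

Let nonadj i j : (i.+1 < j < m.+3)%N -> ~~ unit_step (C i) (C j).
Proof.
move=> /andP[ij jm]; have [|_] := sC (i := i) (j := j); first by rewrite (ltnW ij).
by move=> ->; rewrite neq_ltn ij.
Qed.

Lemma side_wt_le e c : c \in cs -> c \in beside e -> w e <= wt 2 2.
Proof.
move=> cin /ends_quadrants[qo qd].
by apply: wt_anti; rewrite (deg_ge2 tG cin).
Qed.

Lemma side_wt_le33 e c c1 c2 : c \in cs -> c1 \in cs -> c2 \in cs ->
  c != c1 -> c != c2 -> c \in beside e ->
  (c1 \in quadrants (org e)) || (c2 \in quadrants (org e)) ->
  (c1 \in quadrants (dst e)) || (c2 \in quadrants (dst e)) ->
  w e <= wt 3 3.
Proof.
move=> c0 i1 i2 n1 n2 /ends_quadrants[qo qd] ho hd.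
apply: wt_anti; apply/andP; split=> //.
  by case/orP: ho => h; [apply: (deg_ge3 tG c0 i1)|apply: (deg_ge3 tG c0 i2)].
by case/orP: hd => h; [apply: (deg_ge3 tG c0 i1)|apply: (deg_ge3 tG c0 i2)].
Qed.

Lemma end_square_le c c' : c \in cs -> unit_step c c' ->
  \sum_(e <- side_list c) w e - w (border c c') <= 3 * wt 2 2.
Proof.
move=> cin /end_sides[e1 [e2 [e3 p]]].
have le e : e \in [:: border c c'; e1; e2; e3] -> w e <= wt 2 2.
  by rewrite -(perm_mem p) mem_side_list; apply: side_wt_le.
rewrite (perm_big _ p) !big_cons big_nil /=.
have h1 : w e1 <= wt 2 2 by apply: le; rewrite !inE eqxx ?orbT.
have h2 : w e2 <= wt 2 2 by apply: le; rewrite !inE eqxx ?orbT.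
have h3 : w e3 <= wt 2 2 by apply: le; rewrite !inE eqxx ?orbT.
lra.
Qed.

Definition straight_at (i : nat) : bool := straight (C i) (C i.+1) (C i.+2).

Lemma middle_square_le i : (i < m.+1)%N ->
  \sum_(e <- side_list (C i.+1)) w e
    - w (border (C i) (C i.+1)) - w (border (C i.+1) (C i.+2))
  <= 2 * wt 2 2 - 2 * (wt 2 2 - wt 3 3) * (straight_at i)%:R.
Proof.
move=> im.
have u01 : unit_step (C i) (C i.+1) by apply: step; lia.
have u12 : unit_step (C i.+1) (C i.+2) by apply: step; lia.
have n01 : C i.+1 != C i by rewrite eq_sym neq //; lia.
have n12 : C i.+1 != C i.+2 by rewrite neq //; lia.
have n02 : C i != C i.+2 by rewrite neq //; lia.
have [i0 i1 i2] : [/\ C i \in cs, C i.+1 \in cs & C i.+2 \in cs].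
  by split; apply: mem; lia.
have [e [e' [p st]]] := inner_sides u01 u12 n02.
have be f : f \in [:: e; e'] -> C i.+1 \in beside f.
  by move=> h; rewrite -mem_side_list (perm_mem p) 2!inE h !orbT.
have e1 : e \in [:: e; e'] by rewrite !inE eqxx.
have e2 : e' \in [:: e; e'] by rewrite !inE eqxx orbT.
rewrite (perm_big _ p) !big_cons big_nil /=.
rewrite /straight_at; case: (boolP (straight _ _ _)) => s; rewrite ?mulr1 ?mulr0.
  have le f : f \in [:: e; e'] -> w f <= wt 3 3.
    move=> h; have /andP[ho hd] := st s f h.
    exact: (side_wt_le33 i1 i0 i2 n01 n12 (be f h) ho hd).
  have := le _ e1; have := le _ e2; lra.
have := side_wt_le i1 (be _ e1); have := side_wt_le i1 (be _ e2); lra.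
Qed.

Lemma border_ge3 i : (i < m.+2)%N ->
  (3 <= deg G (org (border (C i) (C i.+1))))%N /\
  (3 <= deg G (dst (border (C i) (C i.+1))))%N.
Proof.
move=> im; have u : unit_step (C i) (C i.+1) by apply: step; lia.
have [/ends_quadrants[a b] /ends_quadrants[a' b']] := border_beside u.
have n01 : C i != C i.+1 by rewrite neq //; lia.
have [i0 i1] : C i \in cs /\ C i.+1 \in cs by split; apply: mem; lia.
by split; apply: (deg_ge3 tG i0 i1).
Qed.

Lemma border_ge4 i k p : (i < m.+2)%N -> (k < m.+3)%N -> k != i -> k != i.+1 ->
  p \in [:: org (border (C i) (C i.+1)); dst (border (C i) (C i.+1))] ->
  C k \in quadrants p -> (4 <= deg G p)%N.
Proof.
move=> im km ki ki'; have u : unit_step (C i) (C i.+1) by apply: step; lia.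
have [n01 n02 n12] : [/\ C i != C i.+1, C i != C k & C i.+1 != C k].
  split; first by apply: neq; lia.
    have [h|h] := ltnP i k; first by apply: neq; lia.
    by rewrite eq_sym; apply: neq; lia.
  have [h|h] := ltnP i.+1 k; first by apply: neq; lia.
  by rewrite eq_sym; apply: neq; lia.
have i0 : C i \in cs by apply: mem; lia.
have i1 : C i.+1 \in cs by apply: mem; lia.
have i2 : C k \in cs by apply: mem; lia.
have [/ends_quadrants[a b] /ends_quadrants[a' b']] := border_beside u.
rewrite inE mem_seq1 => /orP[]/eqP-> kp; exact: (deg_ge4 tG i0 i1 i2 n01 n12 n02).
Qed.

Local Notation b i := (border (C i) (C i.+1)).

Lemma border_le33 i : (i < m.+2)%N -> w (b i) <= wt 3 3.
Proof. by move=> /border_ge3[h h']; apply: wt_anti; rewrite ?h ?h'. Qed.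

Lemma border_le34 i k : (i < m.+2)%N -> (k < m.+3)%N -> k != i -> k != i.+1 ->
  (C k \in quadrants (org (b i))) || (C k \in quadrants (dst (b i))) ->
  w (b i) <= wt 3 4.
Proof.
move=> im km ki ki' h; have [ho hd] := border_ge3 im.
case/orP: h => /(border_ge4 im km ki ki') h4; last first.
  by apply: wt_anti; rewrite ?ho ?h4 // !inE eqxx orbT.
by rewrite wtC; apply: wt_anti; rewrite ?hd ?h4 // !inE eqxx.
Qed.

Lemma turn_before_le34 i : (i < m.+1)%N -> ~~ straight_at i -> w (b i.+1) <= wt 3 4.
Proof.
move=> im s; apply: (@border_le34 _ i); try lia.
by apply: turn_before => //; [apply: step|apply: step|apply: neq]; lia.
Qed.

Lemma turn_after_le34 i : (i < m.+1)%N -> ~~ straight_at i -> w (b i) <= wt 3 4.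
Proof.
move=> im s; apply: (@border_le34 _ i.+2); try lia.
by apply: turn_after => //; [apply: step|apply: step|apply: neq]; lia.
Qed.

Lemma turns_step i : (i < m)%N -> ~~ straight_at i -> ~~ straight_at i.+1 ->
  C i.+3 = ((C i.+2).1 + ((C i.+1).1 - (C i).1), (C i.+2).2 + ((C i.+1).2 - (C i).2)).
Proof.
move=> im s s'; apply: turns_alternate => //.
all: do ?[by apply: step; lia|by apply: neq; lia|by apply: nonadj; lia].
Qed.

Lemma turns_le44 i : (i < m)%N -> ~~ straight_at i -> ~~ straight_at i.+1 ->
  w (b i.+1) <= wt 4 4.
Proof.
move=> im s s'.
have h0 p : p \in [:: org (b i.+1); dst (b i.+1)] -> C i \in quadrants p ->
    (4 <= deg G p)%N by apply: border_ge4; lia.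
have h3 p : p \in [:: org (b i.+1); dst (b i.+1)] -> C i.+3 \in quadrants p ->
    (4 <= deg G p)%N by apply: border_ge4; lia.
have oin : org (b i.+1) \in [:: org (b i.+1); dst (b i.+1)] by rewrite !inE eqxx.
have din : dst (b i.+1) \in [:: org (b i.+1); dst (b i.+1)] by rewrite !inE eqxx orbT.
have u01 : unit_step (C i) (C i.+1) by apply: step; lia.
have u12 : unit_step (C i.+1) (C i.+2) by apply: step; lia.
have n02 : C i != C i.+2 by apply: neq; lia.
case/orP: (turn_both u01 u12 n02 s (turns_step im s s')).
- by move=> /andP[/(h0 _ oin) ho /(h3 _ din) hd]; apply: wt_anti; rewrite ?ho ?hd.
- by move=> /andP[/(h0 _ din) hd /(h3 _ oin) ho]; apply: wt_anti; rewrite ?ho ?hd.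
Qed.

Local Notation delta := (wt 3 4 - wt 4 4).

Lemma first_border_le : w (b 0) <= wt 3 4 + delta * (straight_at 0)%:R.
Proof.
have := wt_concave R; have := border_le33 (ltn0Sn m.+1); have := @turn_after_le34 0 isT.
case: straight_at => /=; rewrite ?mulr1 ?mulr0; last by move=> /(_ isT); lra.
by move=> _; lra.
Qed.

Lemma last_border_le : w (b m.+1) <= wt 3 4 + delta * (straight_at m)%:R.
Proof.
have := wt_concave R; have := border_le33 (ltnSn m.+1).
have := @turn_before_le34 m (ltnSn m).
case: straight_at => /=; rewrite ?mulr1 ?mulr0; last by move=> /(_ isT); lra.
by move=> _; lra.
Qed.

(** Concavity of the weights makes the bound for two straight passages follow from
    that for one. *)
Lemma middle_border_le j : (j < m)%N ->
  w (b j.+1) <= wt 4 4 + delta * ((straight_at j)%:R + (straight_at j.+1)%:R).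
Proof.
move=> jm; have jm1 : (j < m.+1)%N by exact: ltnW.
have := wt_concave R; have h := @border_le33 j.+1 jm1.
have := turn_before_le34 jm1; have := @turn_after_le34 j.+1 jm; have := turns_le44 jm.
move: h; case: (straight_at j); case: (straight_at j.+1) => /= h h44 h1 h2 conc.
- by lra.
- by have := h1 isT; lra.
- by have := h2 isT; lra.
- by have := h44 isT isT; lra.
Qed.

(** The index of the zigzag chain with n = m + 3 squares: 2 n + 2 unshared edges, the
    first and the last border with one end of degree 4, and n - 3 other borders with
    both ends of degree 4. *)
Definition zigzag_value : R :=
  (2 * m + 8)%:R * wt 2 2 + 2 * wt 3 4 + m%:R * wt 4 4.

(** Each straight passage loses wt 2 2 - wt 3 3 on two unshared sides and wins at
    most delta on two borders. *)
Lemma strip_bound :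
  ABC R G <= zigzag_value
    - 2 * (wt 2 2 - wt 3 3 - delta) * \sum_(i < m.+1) (straight_at i)%:R.
Proof.
have -> : ABC R G = \sum_(i < m.+3) \sum_(e <- side_list (C i)) w e
    - \sum_(i < m.+2) w (b i).
  by rewrite -(strip_sum _ sC) -(tiles_eq tG).
rewrite (sum_regroup _ (fun i => \sum_(e <- side_list (C i)) w e) (fun i => w (b i))).
have h0 := end_square_le (mem (ltn0Sn _)) (@step 0 isT).
have h1 : \sum_(e <- side_list (C m.+2)) w e - w (b m.+1) <= 3 * wt 2 2.
  by rewrite borderC ?step //; apply: end_square_le; rewrite ?mem // unit_stepC step.
have h2 : \sum_(i < m.+1) (\sum_(e <- side_list (C i.+1)) w e - w (b i) - w (b i.+1))
    <= m.+1%:R * (2 * wt 2 2)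
       - 2 * (wt 2 2 - wt 3 3) * \sum_(i < m.+1) (straight_at i)%:R.
  apply: (le_trans (ler_sum _ (fun i _ => middle_square_le (ltn_ord i)))).
  by rewrite sumrB sumr_const card_ord -mulr_sumr -[_ *+ m.+1]mulr_natl.
have h3 : w (b 0) + w (b m.+1) + \sum_(j < m) w (b j.+1) <=
    2 * wt 3 4 + m%:R * wt 4 4 + 2 * delta * \sum_(i < m.+1) (straight_at i)%:R.
  have k : \sum_(j < m) w (b j.+1) <= m%:R * wt 4 4 +
      delta * (\sum_(i < m) (straight_at i)%:R + \sum_(i < m) (straight_at i.+1)%:R).
    apply: (le_trans (ler_sum _ (fun i _ => middle_border_le (ltn_ord i)))).
    by rewrite big_split /= sumr_const card_ord -[_ *+ m]mulr_natl -mulr_sumr big_split.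
  have e1 : \sum_(i < m.+1) (straight_at i)%:R =
      (straight_at 0)%:R + \sum_(i < m) (straight_at i.+1)%:R :> R.
    by rewrite big_ord_recl.
  have e2 : \sum_(i < m.+1) (straight_at i)%:R =
      \sum_(i < m) (straight_at i)%:R + (straight_at m)%:R :> R.
    by rewrite big_ord_recr.
  have := first_border_le; have := last_border_le; move: k e1 e2.
  move: (\sum_(i < m.+1) _) (\sum_(i < m) _)
    (\sum_(i < m) (straight_at _.+1)%:R) => S S1 S2.
  move=> k e1 e2 k1 k2.
  (* Each straight passage is counted at both borders of its square. *)
  have -> : 2 * delta * S = delta * (S + S) by ring.
  rewrite {1}e1 e2.
  have -> : delta * ((straight_at 0)%:R + S2 + (S1 + (straight_at m)%:R)) =
    delta * (straight_at 0)%:R + delta * (straight_at m)%:R + delta * (S1 + S2) by ring.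
  by lra.
have e : (2 * m + 8)%:R = 2 * m.+1%:R + 6 :> R.
  by rewrite natrD natrM -natr1; ring.
rewrite /zigzag_value e; move: h0 h1 h2 h3.
move: (\sum_(i < m.+1) (straight_at _)%:R) (\sum_(i < m.+1) _)
  (\sum_(j < m) _) => S S1 S2.
move: (m.+1%:R) (m%:R) (\sum_(e <- side_list (C m.+2)) _) => M1 M T h0 h1 h2 h3.
have -> : (2 * M1 + 6) * wt 2 2 = M1 * (2 * wt 2 2) + 6 * wt 2 2 by ring.
have -> : 2 * (wt 2 2 - wt 3 3 - delta) * S =
  2 * (wt 2 2 - wt 3 3) * S - 2 * delta * S by ring.
move: (M1 * _) (M * _) (2 * (wt 2 2 - wt 3 3) * S) (2 * delta * S) h2 h3 => *.
by lra.
Qed.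
End Strip.

(** * The staircase *)

Definition stair (i : nat) : cell := ((uphalf i)%:Z, (i./2)%:Z).

(** The cell on the antidiagonal x + y = i is the i-th one. *)
Lemma mem_stair (n : nat) (x y : int) : ((x, y) \in mkseq stair n) =
  [&& 0 <= x + y, x + y < n%:Z & (x == y) || (x == y + 1)].
Proof.
apply/mapP/idP => [[i]|h].
  by rewrite mem_iota /stair => ? [-> ->]; lia.
exists (absz (x + y)); rewrite ?mem_iota; first by lia.
by rewrite /stair; congr (_, _); lia.
Qed.

Lemma stair_strip n : strip n stair.
Proof.
move=> i j ij; rewrite /unit_step /stair xpair_eqE /=.
split; lia.
Qed.

Section Stair.
Variables (R : realType) (m : nat).
Let G := cells_graph (mkseq stair m.+3).
Let tG : tiles G (mkseq stair m.+3).
Proof. exact: cells_graph_tiles. Qed.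
Local Notation wt := (abc_wt R).
Local Notation w := (edge_wt R G).
Local Notation b i := (border (stair i) (stair i.+1)).

(** In a staircase two cells that meet in a corner without sharing a side never
    lie across the direction of the diagonal: this is why degrees stay below 4
    near the ends and on the outer corners. *)
Lemma stair_antidiagonal x y :
  ((x, y - 1) \in mkseq stair m.+3) && ((x - 1, y) \in mkseq stair m.+3) = false.
Proof. by rewrite !mem_stair; lia. Qed.

Lemma stair_deg_le2 x y :
  (x != y) && (x != y + 1) || (x + y <= 0) || (x + y >= m.+4%:Z) -> (deg G (x, y) <= 2)%N.
Proof.
move=> h; rewrite (deg_tiles _ _ tG); have := stair_antidiagonal x y.
have [] : ((x, y - 1) \in mkseq stair m.+3 = false /\
   (x - 1, y) \in mkseq stair m.+3 = false /\
   ((x, y) \in mkseq stair m.+3) && ((x - 1, y - 1) \in mkseq stair m.+3) = false)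
  \/ ((x, y) \in mkseq stair m.+3 = false /\ (x - 1, y - 1) \in mkseq stair m.+3 = false).
- rewrite !mem_stair; lia.
- case=> -> [-> ]; case: (_ \in _); case: (_ \in _) => //.
- case=> -> ->; case: (_ \in _); case: (_ \in _) => //.
Qed.

Lemma stair_deg_le3 x y :
  (x + y <= 1) || (x + y >= m.+3%:Z) -> (deg G (x, y) <= 3)%N.
Proof.
move=> h; rewrite (deg_tiles _ _ tG); have := stair_antidiagonal x y.
have : ((x, y) \in mkseq stair m.+3) && ((x - 1, y - 1) \in mkseq stair m.+3) = false.
  by rewrite !mem_stair; lia.
case: ((x, y) \in _); case: ((x, y - 1) \in _); case: ((x - 1, y) \in _);
  case: ((x - 1, y - 1) \in _) => //.
Qed.

Lemma stair_edge_ge22 i e : (i < m.+3)%N -> stair i \in beside e ->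
  (deg G (org e) <= 2)%N || (deg G (dst e) <= 2)%N -> wt 2 2 <= w e.
Proof.
move=> im ie; have ic : stair i \in mkseq stair m.+3 by rewrite map_f ?mem_iota.
have [/(deg_ge2 tG ic) ho /(deg_ge2 tG ic) hd] := ends_quadrants ie.
rewrite /edge_wt => /orP[] h.
  have -> : deg G (org e) = 2%N by lia.
  by rewrite [leRHS]wt2 // (leq_trans _ hd).
have -> : deg G (dst e) = 2%N by lia.
by rewrite [leRHS]wtC [leRHS]wt2 // (leq_trans _ ho).
Qed.

Lemma stair_edge_ge44 i e : (i < m.+3)%N -> stair i \in beside e -> wt 4 4 <= w e.
Proof.
move=> im ie; have ic : stair i \in mkseq stair m.+3 by rewrite map_f ?mem_iota.
have [/(deg_ge2 tG ic) ho /(deg_ge2 tG ic) hd] := ends_quadrants ie.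
by apply: wt_anti; rewrite ?ho ?hd deg_le4.
Qed.

Lemma stair_edge_ge34 i e : (i < m.+3)%N -> stair i \in beside e ->
  (deg G (org e) <= 3)%N || (deg G (dst e) <= 3)%N -> wt 3 4 <= w e.
Proof.
move=> im ie; have ic : stair i \in mkseq stair m.+3 by rewrite map_f ?mem_iota.
have [/(deg_ge2 tG ic) ho /(deg_ge2 tG ic) hd] := ends_quadrants ie.
move=> /orP[] h; last rewrite wtC; by apply: wt_anti; rewrite ?ho ?hd ?h ?deg_le4.
Qed.

Lemma stair_even k : stair k.*2 = (k%:Z, k%:Z).
Proof. by rewrite /stair; congr (_, _); lia. Qed.

Lemma stair_odd k : stair k.*2.+1 = (k%:Z + 1, k%:Z).
Proof. by rewrite /stair; congr (_, _); lia. Qed.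

Lemma border_even k : b k.*2 = ((k%:Z + 1, k%:Z), true).
Proof.
rewrite stair_even stair_odd /border /=.
have -> : (k%:Z == k%:Z + 1) = false by lia.
by congr (_, _, _); lia.
Qed.

Lemma border_odd k : b k.*2.+1 = ((k%:Z + 1, k%:Z + 1), false).
Proof.
rewrite -doubleS stair_even stair_odd /border /=.
have -> : (k%:Z + 1 == k.+1%:Z) by lia.
by congr (_, _, _); lia.
Qed.

(** The two unshared sides of an inner cell meet in its outer corner, which has
    degree 2. *)
Lemma stair_middle_ge i : (i < m.+1)%N ->
  2 * wt 2 2 <= \sum_(e <- side_list (stair i.+1)) w e - w (b i) - w (b i.+1).
Proof.
move=> im; have [k [ek|ek]] : exists k, i = k.*2 \/ i = k.*2.+1.
- by exists i./2; case: (boolP (odd i)) => h; [right|left]; lia.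
- rewrite ek border_even border_odd stair_odd /side_list !big_cons big_nil /=.
  have h1 : wt 2 2 <= w ((k%:Z + 1, k%:Z), false).
    apply: (@stair_edge_ge22 i.+1); rewrite ?ek ?stair_odd ?inE ?eqxx ?orbT //;
      first by lia.
    by rewrite /org /dst /=; apply/orP; right; apply: stair_deg_le2; lia.
  have h2 : wt 2 2 <= w ((k%:Z + 1 + 1, k%:Z), true).
    apply: (@stair_edge_ge22 i.+1); rewrite ?ek ?stair_odd ?inE /=; first by lia.
      by rewrite !xpair_eqE; lia.
    by rewrite /org /dst /=; apply/orP; left; apply: stair_deg_le2; lia.
  lra.
- rewrite ek border_odd -doubleS border_even stair_even /side_list !big_cons big_nil /=.
  have -> : k.+1%:Z = k%:Z + 1 :> int by lia.
  have h1 : wt 2 2 <= w ((k%:Z + 1, k%:Z + 1), true).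
    apply: (@stair_edge_ge22 i.+1);
      rewrite ?ek -?doubleS ?stair_even ?inE /=; first by lia.
      by rewrite !xpair_eqE; lia.
    by rewrite /org /dst /=; apply/orP; right; apply: stair_deg_le2; lia.
  have h2 : wt 2 2 <= w ((k%:Z + 1, k%:Z + 1 + 1), false).
    apply: (@stair_edge_ge22 i.+1);
      rewrite ?ek -?doubleS ?stair_even ?inE /=; first by lia.
      by rewrite !xpair_eqE; lia.
    by rewrite /org /dst /=; apply/orP; left; apply: stair_deg_le2; lia.
  lra.
Qed.

Lemma stair_first_ge :
  3 * wt 2 2 <= \sum_(e <- side_list (stair 0)) w e - w (b 0).
Proof.
have -> : b 0 = ((1, 0), true) by exact: (border_even 0).
have e0 : stair 0 = (0, 0) by exact: (stair_even 0).
rewrite e0 /side_list !big_cons big_nil /= !add0r.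
have ge e : (0, 0) \in beside e -> (deg G (org e) <= 2)%N || (deg G (dst e) <= 2)%N ->
  wt 2 2 <= w e by rewrite -e0; apply: stair_edge_ge22.
have h1 : wt 2 2 <= w ((0, 0), false).
  by apply: ge; rewrite // /org /=; apply/orP; left; apply: stair_deg_le2; lia.
have h2 : wt 2 2 <= w ((0, 0), true).
  by apply: ge; rewrite // /org /=; apply/orP; left; apply: stair_deg_le2; lia.
have h3 : wt 2 2 <= w ((0, 1), false).
  by apply: ge; rewrite // /org /=; apply/orP; left; apply: stair_deg_le2; lia.
lra.
Qed.

Lemma stair_last_ge :
  3 * wt 2 2 <= \sum_(e <- side_list (stair m.+2)) w e - w (b m.+1).
Proof.
have ge e : stair m.+2 \in beside e -> (deg G (org e) <= 2)%N || (deg G (dst e) <= 2)%N ->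
  wt 2 2 <= w e by apply: stair_edge_ge22.
have [k [ek|ek]] : exists k, m.+1 = k.*2 \/ m.+1 = k.*2.+1.
- by exists (m.+1)./2; case: (boolP (odd m.+1)) => h; [right|left]; lia.
- rewrite ek border_even; rewrite ek in ge;
  rewrite stair_odd in ge *; rewrite /side_list !big_cons big_nil /=.
  have h1 : wt 2 2 <= w ((k%:Z + 1, k%:Z), false).
    apply: ge; first by rewrite !inE /= !xpair_eqE; lia.
    by rewrite /org /dst /=; apply/orP; right; apply: stair_deg_le2; lia.
  have h2 : wt 2 2 <= w ((k%:Z + 1, k%:Z + 1), false).
    apply: ge; first by rewrite !inE /= !xpair_eqE; lia.
    by rewrite /org /dst /=; apply/orP; right; apply: stair_deg_le2; lia.
  have h3 : wt 2 2 <= w ((k%:Z + 1 + 1, k%:Z), true).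
    apply: ge; first by rewrite !inE /= !xpair_eqE; lia.
    by rewrite /org /dst /=; apply/orP; left; apply: stair_deg_le2; lia.
  lra.
- rewrite ek border_odd; rewrite ek in ge;
  rewrite -doubleS stair_even in ge *; rewrite /side_list !big_cons big_nil /=.
  have e1 : k.+1%:Z = k%:Z + 1 :> int by lia.
  rewrite e1 in ge *.
  have h1 : wt 2 2 <= w ((k%:Z + 1, k%:Z + 1), true).
    apply: ge; first by rewrite !inE /= !xpair_eqE; lia.
    by rewrite /org /dst /=; apply/orP; right; apply: stair_deg_le2; lia.
  have h2 : wt 2 2 <= w ((k%:Z + 1, k%:Z + 1 + 1), false).
    apply: ge; first by rewrite !inE /= !xpair_eqE; lia.
    by rewrite /org /dst /=; apply/orP; left; apply: stair_deg_le2; lia.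
  have h3 : wt 2 2 <= w ((k%:Z + 1 + 1, k%:Z + 1), true).
    apply: ge; first by rewrite !inE /= !xpair_eqE; lia.
    by rewrite /org /dst /=; apply/orP; right; apply: stair_deg_le2; lia.
  lra.
Qed.

Lemma stair_border_beside i : stair i \in beside (b i).
Proof.
have [|_] := stair_strip (n := i.+2) (i := i) (j := i.+1); first by rewrite !ltnSn.
by rewrite eqxx => /border_beside[].
Qed.

Lemma stair_value_le : zigzag_value R m <= ABC R G.
Proof.
have -> : ABC R G = \sum_(i < m.+3) \sum_(e <- side_list (stair i)) w e
    - \sum_(i < m.+2) w (b i).
  by rewrite -(strip_sum _ (@stair_strip _)).
rewrite (sum_regroup _ (fun i => \sum_(e <- side_list (stair i)) w e) (fun i => w (b i))).
have h0 : wt 3 4 <= w (b 0).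
  apply: (@stair_edge_ge34 0) => //.
  have -> : b 0 = ((1, 0), true) by exact: (border_even 0).
  by rewrite /org /=; apply/orP; left; apply: stair_deg_le3; lia.
have h1 : wt 3 4 <= w (b m.+1).
  apply: (@stair_edge_ge34 m.+1); [lia|exact: stair_border_beside|].
  have [k [ek|ek]] : exists k, m.+1 = k.*2 \/ m.+1 = k.*2.+1.
  - by exists (m.+1)./2; case: (boolP (odd m.+1)) => h; [right|left]; lia.
  - by rewrite ek border_even /org /dst /=; apply/orP; right; apply: stair_deg_le3; lia.
  - by rewrite ek border_odd /org /dst /=; apply/orP; right; apply: stair_deg_le3; lia.
have h2 : m%:R * wt 4 4 <= \sum_(j < m) w (b j.+1).
  rewrite mulr_natl -[X in _ *+ X](card_ord m) -sumr_const; apply: ler_sum => i _.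
  by apply: (@stair_edge_ge44 i.+1); [have := ltn_ord i; lia|exact: stair_border_beside].
have h3 : m.+1%:R * (2 * wt 2 2) <=
    \sum_(i < m.+1) (\sum_(e <- side_list (stair i.+1)) w e - w (b i) - w (b i.+1)).
  rewrite mulr_natl -[X in _ *+ X](card_ord m.+1) -sumr_const; apply: ler_sum => i _.
  exact: stair_middle_ge.
have := stair_first_ge; have := stair_last_ge.
have e : (2 * m + 8)%:R = 2 * m.+1%:R + 6 :> R.
  by rewrite natrD natrM -natr1; ring.
rewrite /zigzag_value e; move: h0 h1 h2 h3.
have -> : (2 * m.+1%:R + 6) * wt 2 2 = m.+1%:R * (2 * wt 2 2) + 6 * wt 2 2 by ring.
move: (m.+1%:R * _) (m%:R * _) => * /=.
lra.
Qed.
End Stair.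

(** * Chains are strips; zigzag chains always turn *)

Lemma chain_strip n G : polyomino_chain n G ->
  exists C, [/\ strip n C, tiles G (mkseq C n) &
                forall i, (i < n)%N -> C i \in squares G].
Proof.
case=> sys _ [t [ut tsq tadj]]; exists (nth (0, 0) t).
have mt : mkseq (nth (0, 0) t) n = t.
  by rewrite -[X in mkseq _ X](size_tuple t) mkseq_nth.
split; last by move=> i ilt; rewrite -tsq mem_nth ?size_tuple.
  move=> i j /andP[ij jn]; have ilt := ltn_trans ij jn; split.
    by rewrite nth_uniq ?size_tuple // neq_ltn ij.
  rewrite -sq_adjacent_unit.
  have := tadj (Ordinal ilt) (Ordinal jn); rewrite !(tnth_nth (0, 0)) /= => ->.
  by rewrite [X in _ || X]gtn_eqF ?orbF // ltnS ltnW.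
move=> e; rewrite mt; apply/idP/hasP => [eG|[c ct ec]].
  have [c cs ec] := edge_in_square sys eG.
  by exists c; [rewrite tsq|rewrite -mem_sides].
move: ct; rewrite tsq => /imfsetP[c' /= + e'].
rewrite -{}e' => /andP[_ /fsubsetP sub].
by apply: sub; rewrite mem_sides.
Qed.

Lemma straight_corner c0 c1 c2 p : unit_step c0 c1 -> straight c0 c1 c2 ->
  c1 \in quadrants p -> (c0 \in quadrants p) || (c2 \in quadrants p).
Proof.
case: c2 => x2 y2; rewrite unit_stepC => /neighbour_cases[][-> _];
  rewrite /straight; case: p => a d; case: c1 => x y; rewrite !inE /= !xpair_eqE; lia.
Qed.

(** On a straight passage all corners of the middle square belong to a second square
    as well, so that none of them has degree 2. *)
Lemma zigzag_turns m Z C : zigzag_chain m.+3 Z -> strip m.+3 C ->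
  tiles Z (mkseq C m.+3) -> (forall i, (i < m.+3)%N -> C i \in squares Z) ->
  forall i, (i < m.+1)%N -> ~~ straight_at C i.
Proof.
move=> [_ kt] sC tZ csq i im; apply/negP => st.
have [n01 u01] : C i != C i.+1 /\ unit_step (C i) (C i.+1) = (i.+1 == i.+1).
  by apply: sC; lia.
have [n12 u12] : C i.+1 != C i.+2 /\
    unit_step (C i.+1) (C i.+2) = (i.+2 == i.+2).
  by apply: sC; lia.
have [n02 _] : C i != C i.+2 /\ unit_step (C i) (C i.+2) = (i.+1 == i.+2).
  by apply: sC; lia.
rewrite eqxx in u01; rewrite eqxx in u12.
have a10 : sq_adjacent (C i.+1) (C i) by rewrite sq_adjacent_unit unit_stepC.
have a12 : sq_adjacent (C i.+1) (C i.+2) by rewrite sq_adjacent_unit.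
have mem k : (k < m.+3)%N -> C k \in mkseq C m.+3.
  by move=> km; apply: map_f; rewrite mem_iota.
have [i0 i1 i2] : [/\ (i < m.+3)%N, (i.+1 < m.+3)%N & (i.+2 < m.+3)%N] by split; lia.
case: (kt _ (csq _ i1)) => [[_ [p pc dp]]|[_ one]].
  rewrite mem_corners in pc.
  have : (3 <= deg Z p)%N.
    case/orP: (straight_corner u01 st pc) => h.
      by apply: (deg_ge3 tZ (mem _ i0) (mem _ i1)).
    by apply: (deg_ge3 tZ (mem _ i1) (mem _ i2)).
  by rewrite dp.
have : ([fset C i; C i.+2] `<=` sq_neighbours Z (C i.+1)).
  apply/fsubsetP => c; rewrite in_fset2 => h; apply/imfsetP; exists c => //.
  case/orP: h => /eqP->; apply/andP; split.
  - exact: csq.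
  - exact: a10.
  - exact: csq.
  - exact: a12.
by move/fsubset_leq_card; rewrite one cardfs2 n02.
Qed.

(** * Strips that always turn are staircases *)

(** This description of adjacency refers to corners of cells only and not to the
    encoding of edges, hence it is easy to transport along lattice symmetries. *)
Lemma adj_tiles G cs p q : tiles G cs ->
  adj G p q =
    unit_step p q && has (fun c => (c \in quadrants p) && (c \in quadrants q)) cs.
Proof.
move=> tG; rewrite adj_step; apply/hasP/andP => [[e eG st]|[u /hasP[c cc /andP[cp cq]]]].
  split; first exact: is_step_unit st.
  move: eG; rewrite tG => /hasP[c cc /ends_quadrants[ho hd]]; apply/hasP; exists c => //.
  by case/orP: st => /andP[/eqP-> /eqP->]; rewrite ho hd.
have [e st] : exists e, is_step e p q.
  case: p q u {cp cq} => p1 p2 [q1 q2] /unit_step_cases[][-> ->].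
  - by exists ((p1, p2), false); rewrite /is_step /org /dst /= !eqxx.
  - by exists ((q1, p2), false); rewrite /is_step /org /dst /= !eqxx orbT.
  - by exists ((p1, p2), true); rewrite /is_step /org /dst /= !eqxx.
  - by exists ((p1, q2), true); rewrite /is_step /org /dst /= !eqxx orbT.
exists e => //; rewrite tG; apply/hasP; exists c => //.
case/orP: st => /andP[/eqP ep /eqP eq]; move: cp cq; rewrite {}ep {}eq !inE /org /dst;
  by case: (e) => -[a d] []; case: c {cc} => x y /=; rewrite !xpair_eqE; lia.
Qed.

Definition lattice_iso (G H : lgraph) : Prop :=
  exists f g : point -> point, [/\ cancel f g, cancel g f &
    forall p q, adj H (f p) (f q) = adj G p q].

Lemma lattice_iso_sym G H : lattice_iso G H -> lattice_iso H G.
Proof.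
move=> [f [g [fK gK fadj]]]; exists g, f; split=> // p q.
by rewrite -fadj !gK.
Qed.

Lemma lattice_iso_trans G H K : lattice_iso G H -> lattice_iso H K -> lattice_iso G K.
Proof.
move=> [f [g [fK gK fadj]]] [f' [g' [fK' gK' fadj']]].
exists (f' \o f), (g \o g'); split; [exact: can_comp|exact: can_comp|].
by move=> p q /=; rewrite fadj' fadj.
Qed.

Lemma vertexP G p : reflect (exists q, adj G p q) (p \in vertices G).
Proof.
rewrite /vertices in_fsetU; apply: (iffP orP) => [[]/imfsetP[e /= eG ->]|[q]].
- exists (dst e); rewrite adj_step; apply/hasP; exists e => //.
  by rewrite /is_step !eqxx.
- exists (org e); rewrite adj_step; apply/hasP; exists e => //.
  by rewrite /is_step !eqxx orbT.
- rewrite adj_step => /hasP[e eG /orP[]/andP[/eqP-> _]]; [left|right];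
    by apply/imfsetP; exists e.
Qed.

Lemma lattice_iso_graph_iso G H : lattice_iso G H -> graph_iso G H.
Proof.
move=> [f [g [fK gK fadj]]]; exists f; split=> [x y _ _|| p q _ _]; last exact: fadj.
  exact: (can_inj fK).
apply/fsetP => x; apply/imfsetP/vertexP => /= [[p /vertexP[q pq] ->]|[y xy]].
  by exists (f q); rewrite fadj.
by exists (g x); rewrite ?gK //; apply/vertexP; exists (g y); rewrite -fadj !gK.
Qed.

Definition affine (o u v p : int * int) : int * int :=
  (o.1 + p.1 * u.1 + p.2 * v.1, o.2 + p.1 * u.2 + p.2 * v.2).

(** By turns_step the steps between consecutive cells repeat with period 2. *)
Lemma turns_coordinates m C : strip m.+3 C ->
  (forall i, (i < m.+1)%N -> ~~ straight_at C i) ->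
  forall i, (i < m.+3)%N ->
    C i = affine (C 0%N) ((C 1%N).1 - (C 0%N).1, (C 1%N).2 - (C 0%N).2)
                 ((C 2%N).1 - (C 1%N).1, (C 2%N).2 - (C 1%N).2) (stair i).
Proof.
move=> sC turn.
pose u : int * int := ((C 1%N).1 - (C 0%N).1, (C 1%N).2 - (C 0%N).2).
pose v : int * int := ((C 2%N).1 - (C 1%N).1, (C 2%N).2 - (C 1%N).2).
pose P i := C i = affine (C 0%N) u v (stair i).
suff H i : (i.+2 < m.+3)%N -> [/\ P i, P i.+1 & P i.+2].
  case=> [|[|i]] ilt; last by have [] := H i ilt.
    by have [] := H 0%N isT.
  by have [] := H 0%N isT.
elim: i => [|i IH] ilt.
  rewrite /P /stair /affine /u /v /=.
  by split; rewrite [LHS]surjective_pairing; congr (_, _); ring.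
have [p0 p1 p2] := IH (ltnW ilt); split=> //.
rewrite /P (turns_step sC _ (turn i _) (turn i.+1 _)); try lia.
rewrite {}p0 {}p1 {}p2 /affine.
have -> : stair i.+1 = ((stair i).2 + 1, (stair i).1).
  by rewrite /stair /=; congr (_, _); lia.
have -> : stair i.+2 = ((stair i).1 + 1, (stair i).2 + 1).
  by rewrite /stair /=; congr (_, _); lia.
have -> : stair i.+3 = ((stair i).2 + 2, (stair i).1 + 1).
  by rewrite /stair /=; congr (_, _); lia.
by congr (_, _) => /=; ring.
Qed.

Definition frame (u v : int * int) : bool :=
  (u \in [:: (1, 0); (-1, 0)]) && (v \in [:: (0, 1); (0, -1)]) ||
  (u \in [:: (0, 1); (0, -1)]) && (v \in [:: (1, 0); (-1, 0)]).

(** A cell is named by its lower left corner, but a symmetry which reverses a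
    direction of the lattice maps that corner to another one.  The map f of points
    therefore differs from the map of cells by the translation k. *)
Lemma frame_iso o u v : frame u v -> exists f g : point -> point,
  [/\ cancel f g, cancel g f, forall p q, unit_step (f p) (f q) = unit_step p q &
      forall s p, (affine o u v s \in quadrants (f p)) = (s \in quadrants p)].
Proof.
move=> fr; pose k (x : int) : int := if x == -1 then 1 else 0.
pose f := affine (o.1 + k (u.1 + v.1), o.2 + k (u.2 + v.2)) u v.
pose g (q : point) :=
  let d := (q.1 - (o.1 + k (u.1 + v.1)), q.2 - (o.2 + k (u.2 + v.2))) in
  (d.1 * u.1 + d.2 * u.2, d.1 * v.1 + d.2 * v.2).
exists f, g; rewrite /f /g /affine {f g}; case: o => a b.
move: fr; rewrite /frame !inE => /orP[]/andP[]/orP[]/eqP-> /orP[]/eqP->;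
  rewrite /k /=.
all: split.
all: try by case=> x y /=; congr (_, _); lia.
all: try by case=> x y [x' y']; rewrite /unit_step /=; lia.
all: by case=> x y [x' y']; rewrite !inE !xpair_eqE /=; lia.
Qed.

Lemma turn_iso m G C : strip m.+3 C -> tiles G (mkseq C m.+3) ->
  (forall i, (i < m.+1)%N -> ~~ straight_at C i) ->
  lattice_iso (cells_graph (mkseq stair m.+3)) G.
Proof.
move=> sC tG turn.
pose u : int * int := ((C 1%N).1 - (C 0%N).1, (C 1%N).2 - (C 0%N).2).
pose v : int * int := ((C 2%N).1 - (C 1%N).1, (C 2%N).2 - (C 1%N).2).
have HC : forall i, (i < m.+3)%N -> C i = affine (C 0%N) u v (stair i).
  exact: turns_coordinates sC turn.
have uv : frame u v.
  have [n02 _] : C 0%N != C 2%N /\ unit_step (C 0%N) (C 2%N) = (1 == 2)%N.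
    exact: sC.
  have [_ u01] : C 0%N != C 1%N /\ unit_step (C 0%N) (C 1%N) = (1 == 1)%N.
    exact: sC.
  have [_ u12] : C 1%N != C 2%N /\ unit_step (C 1%N) (C 2%N) = (2 == 2)%N.
    exact: sC.
  rewrite unit_stepC eqxx in u01; rewrite eqxx in u12.
  move: n02 (turn 0%N isT); rewrite /straight_at /straight /frame /u /v.
  case: (neighbour_cases u01) => -[-> _]; case: (neighbour_cases u12) => -[-> _];
    by case: (C 1%N) => x y; rewrite !inE !xpair_eqE /=; lia.
have [f [g [fK gK fu fq]]] := frame_iso (C 0%N) uv.
exists f, g; split=> // p q.
rewrite (adj_tiles _ _ tG) (adj_tiles _ _ (cells_graph_tiles _)) fu; congr andb.
rewrite !has_map; apply: eq_in_has => i; rewrite mem_iota => /andP[_ im] /=.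
by rewrite HC // !fq.
Qed.

(** * Invariance under isomorphism *)

Lemma sum_pick (V : nmodType) (T : eqType) (s : seq T) (a : T) (F : T -> V) :
  uniq s -> a \in s -> \sum_(x <- s) (if x == a then F x else 0) = F a.
Proof.
by move=> us sa; rewrite (bigD1_seq a) //= eqxx big1 ?addr0 // => x /negPf->.
Qed.

(** Expressing sums over edges through adjacency alone makes them invariant under
    graph isomorphisms, which know nothing about the encoding of edges. *)
Lemma handshake (R : realType) (G : lgraph) (h : point -> point -> R) :
  (forall p q, h p q = h q p) ->
  \sum_(p <- vertices G) \sum_(q <- vertices G) (if adj G p q then h p q else 0)
  = 2 * \sum_(e <- G) h (org e) (dst e).
Proof.
move=> hC; set V := vertices G.
transitivity (\sum_(p <- V) \sum_(q <- V) \sum_(e <- G)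
                (if is_step e p q then h p q else 0)).
  apply: eq_bigr => p _; apply: eq_bigr => q _.
  rewrite adj_step; case: hasP => [[e eG st]|no].
    rewrite (bigD1_seq e) ?fset_uniq //= st big1 ?addr0 // => e' ne.
    by case: ifP => // /(is_step_inj st) ee; rewrite ee eqxx in ne.
  rewrite big_seq big1 // => e eG; case: ifP => // st.
  by case: no; exists e.
under eq_bigr do rewrite exchange_big /=.
rewrite exchange_big /= mulr_sumr big_seq [RHS]big_seq; apply: eq_bigr => e eG.
have oV : org e \in V.
  apply/vertexP; exists (dst e); rewrite adj_step; apply/hasP; exists e => //.
  by rewrite /is_step !eqxx.
have dV : dst e \in V.
  apply/vertexP; exists (org e); rewrite adj_step; apply/hasP; exists e => //.
  by rewrite /is_step !eqxx orbT.
have ne := org_neq_dst e.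
have pick p a : a \in V -> h p a = \sum_(q <- V) (if q == a then h p q else 0).
  by move=> aV; rewrite sum_pick ?fset_uniq.
transitivity (\sum_(p <- V) ((if p == org e then h p (dst e) else 0)
                           + (if p == dst e then h p (org e) else 0))).
  apply: eq_bigr => p _.
  have [->|po] := eqVneq p (org e).
    rewrite (negPf ne) addr0 pick //; apply: eq_bigr => q _.
    by rewrite /is_step eqxx (negPf ne) orbF.
  have [->|pd] := eqVneq p (dst e).
    rewrite add0r pick //; apply: eq_bigr => q _.
    by rewrite /is_step eqxx eq_sym (negPf ne).
  by rewrite addr0 big1 // => q _; rewrite /is_step (negPf po) (negPf pd).
rewrite big_split /= !sum_pick ?fset_uniq // [h (dst e) _]hC.
by rewrite mulr2n mulrDl mul1r.
Qed.

Section Isomorphic.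
Variables (R : realType) (G H : lgraph) (f : point -> point).
Hypothesis f_inj : {in vertices G &, injective f}.
Hypothesis f_im : [fset f p | p in vertices G] = vertices H.
Hypothesis f_adj : {in vertices G &, forall p q, adj H (f p) (f q) = adj G p q}.

Lemma sum_vertices_iso (F : point -> R) :
  \sum_(x <- vertices H) F x = \sum_(p <- vertices G) F (f p).
Proof.
rewrite -(big_map f xpredT F); apply: perm_big; apply: uniq_perm.
- exact: fset_uniq.
- by rewrite map_inj_in_uniq ?fset_uniq.
move=> x; rewrite -f_im; apply/imfsetP/mapP => -[p pV ->]; by exists p.
Qed.

(** Used twice: for indicator functions to compare degrees, then for the weights. *)
Lemma sum_edges_iso (h h' : point -> point -> R) :
  (forall p q, h p q = h q p) -> (forall p q, h' p q = h' q p) ->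
  {in vertices G &, forall p q, h' (f p) (f q) = h p q} ->
  \sum_(e <- H) h' (org e) (dst e) = \sum_(e <- G) h (org e) (dst e).
Proof.
move=> hC hC' hh; have two : 2 != 0 :> R by rewrite pnatr_eq0.
apply: (mulfI two); rewrite -!handshake // sum_vertices_iso big_seq [RHS]big_seq.
apply: eq_bigr => p pV; rewrite sum_vertices_iso big_seq [RHS]big_seq.
by apply: eq_bigr => q qV; rewrite f_adj // hh.
Qed.

Lemma deg_sum (K : lgraph) p :
  (deg K p)%:R = \sum_(e <- K) ((org e == p)%:R + (dst e == p)%:R) :> R.
Proof.
have -> : deg K p = count (fun e => p \in ends e) K.
  rewrite -size_filter /deg; apply: perm_size; apply: uniq_perm.
  - exact: fset_uniq.
  - by rewrite filter_uniq ?fset_uniq.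
  move=> e; rewrite mem_filter andbC.
  by apply/imfsetP/idP => [[e' /= h ->]|h]; last exists e.
rewrite -sum1_count natr_sum big_mkcond; apply: eq_bigr => e _.
rewrite /ends in_fset2 ![p == _]eq_sym; have := org_neq_dst e; rewrite eq_sym.
have [<-|_] := eqVneq (org e) p; last by rewrite add0r /=; case: (dst e == p).
by move=> /negPf->; rewrite addr0.
Qed.

Lemma deg_iso p : p \in vertices G -> deg H (f p) = deg G p.
Proof.
move=> pV; apply/eqP; rewrite -(eqr_nat R) !deg_sum; apply/eqP.
apply: (@sum_edges_iso (fun x y => (x == p)%:R + (y == p)%:R)
                       (fun x y => (x == f p)%:R + (y == f p)%:R)).
- by move=> x y; rewrite addrC.
- by move=> x y; rewrite addrC.
- by move=> x y xV yV /=; rewrite !(inj_in_eq f_inj).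
Qed.

Lemma ABC_iso : ABC R H = ABC R G.
Proof.
apply: (@sum_edges_iso (fun x y => abc_wt R (deg G x) (deg G y))
                       (fun x y => abc_wt R (deg H x) (deg H y))) => [p q|p q|p q pV qV].
- exact: wtC.
- exact: wtC.
- by rewrite !deg_iso.
Qed.
End Isomorphic.

Lemma graph_iso_ABC (R : realType) G H : graph_iso G H -> ABC R G = ABC R H.
Proof. by move=> [f [fi fim fa]]; rewrite (ABC_iso R fi fim fa). Qed.

(** * The extremal chain *)

Theorem theorem2p20 (R : realType) (n : nat) (B Z : lgraph)
    (hn : (3 <= n)%N)
    (hB : polyomino_chain n B) (hZ : zigzag_chain n Z) :
  ABC R B <= ABC R Z /\ (ABC R B = ABC R Z <-> graph_iso B Z).
Proof.
case: n hn hB hZ => [|[|[|m]]] // _ hB hZ.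
have [C [sC tB _]] := chain_strip hB.
have [D [sD tZ Dsq]] := chain_strip hZ.1.
have turnZ := zigzag_turns hZ sD tZ Dsq.
have isoZ := turn_iso sD tZ turnZ.
have zV : zigzag_value R m <= ABC R Z.
  by rewrite -(graph_iso_ABC R (lattice_iso_graph_iso isoZ)) stair_value_le.
have bV := strip_bound R sC tB.
have gap : 0 < 2 * (abc_wt R 2 2 - abc_wt R 3 3 - (abc_wt R 3 4 - abc_wt R 4 4)).
  by have := wt_gap R; lra.
have S0 : 0 <= \sum_(i < m.+1) (straight_at C i)%:R :> R by apply: sumr_ge0.
have le : ABC R B <= ABC R Z.
  apply: le_trans bV (le_trans _ zV).
  by rewrite lerBlDr lerDl mulr_ge0 // ltW.
split=> //; split=> [eqBZ|]; last exact: graph_iso_ABC.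
have S00 : \sum_(i < m.+1) (straight_at C i)%:R = 0 :> R.
  apply/eqP; rewrite eq_le S0 andbT.
  rewrite -(pmulr_rle0 _ gap); move: bV; rewrite eqBZ.
  by move: (_ * \sum_(i < _) _) => x; lra.
apply: lattice_iso_graph_iso; apply: lattice_iso_trans isoZ.
apply: lattice_iso_sym; apply: turn_iso sC tB _ => i im.
have : (straight_at C (Ordinal im))%:R = 0 :> R.
  exact: (psumr_eq0P (F := fun j : 'I_m.+1 => (straight_at C j)%:R) _ S00).
by case: straight_at => //= /eqP; rewrite oner_eq0.
Qed.
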